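(* Let $d\ge 1$ and let $K\subset\mathbb R^d$ be a strictly convex body. Then there exist at least $\kappa(d)$ distinct affine diameters of $K$ having a common point in the interior of $K$.
   Context: $\kappa(d)$ denotes the largest integer $k$ with the following property: for every continuous map $f:\mathbb RP^d\to S^d$ there exists $x\in S^d$ such that $|f^{-1}(x)|\ge k$, where $|f^{-1}(x)|$ is the cardinality of the preimage. A convex body is a compact convex set with nonempty interior; it is strictly convex if its boundary contains no nondegenerate segment. An affine diameter of $K$ is a longest section of $K$ by a straight line in a given direction; that is, for a direction $\ell\in\mathbb RP^{d-1}$, it is a segment $K\cap L$ of maximal length among all lines $L$ parallel to $\ell$. *)

(* Defs.v *)
From HB Require Import structures.
From mathcomp Require Import all_boot all_order all_algebra.
From mathcomp Require Import all_classical all_reals all_analysis.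

Set Implicit Arguments.
Unset Strict Implicit.
Unset Printing Implicit Defensive.

Import Order.TTheory GRing.Theory Num.Theory.
Import numFieldNormedType.Exports.

Local Open Scope classical_set_scope.
Local Open Scope ring_scope.
Local Open Scope quotient_scope.
Local Open Scope card_scope.

(* The library norm on ['rV[R]_n] is the sup norm; its topology is the usual
   one, but lengths and the round sphere need the Euclidean norm. *)
Definition enorm (R : realType) (n : nat) (x : 'rV[R]_n) : R :=
  Num.sqrt (\sum_i x ord0 i ^+ 2).

Definition sphere (R : realType) (d : nat) : set 'rV[R]_d.+1 :=
  [set x | enorm x = 1].
Arguments sphere : clear implicits.

Section projective_space.
Variables (R : realType) (d : nat).

Let antipodal' (x y : sphere R d) : bool :=
  (val x == val y) || (val x == - val y).

Local Lemma antipodal_refl : reflexive antipodal'.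
Proof. by move=> x; rewrite /antipodal' eqxx. Qed.

Local Lemma antipodal_sym : symmetric antipodal'.
Proof.
move=> x y; rewrite /antipodal' (eq_sym (val x)) -eqr_oppLR.
by rewrite (eq_sym (- val x)).
Qed.

Local Lemma antipodal_trans : transitive antipodal'.
Proof.
move=> y x z; rewrite /antipodal'.
move=> /orP[/eqP->//|/eqP->] /orP[/eqP->|/eqP->]; first by rewrite eqxx orbT.
by rewrite opprK eqxx.
Qed.

Definition antipodal : equiv_rel (sphere R d) :=
  EquivRel antipodal' antipodal_refl antipodal_sym antipodal_trans.

Definition RP : topologicalType := quotient_topology {eq_quot antipodal}.

End projective_space.
Arguments RP : clear implicits.

Section kappa.
Variables (R : realType) (d : nat).

Definition has_large_fiber (k : nat) : Prop :=
  forall f : RP R d -> sphere R d, continuous f ->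
    exists x : sphere R d, `I_k #<= f @^-1` [set x].

(* [kappa] exists: [k = 0] qualifies, and [k] is bounded because the map
   [x] |-> (x_i ^ 2)_i / |(x_i ^ 2)_i| has finite fibers of bounded size. *)

Local Lemma sphere_sumsq (x : sphere R d) : \sum_i val x ord0 i ^+ 2 = 1.
Proof.
have /set_mem/= := valP x; rewrite /sphere/= /enorm => h.
by rewrite -[LHS]sqr_sqrtr ?h ?expr1n// sumr_ge0// => i _; exact: sqr_ge0.
Qed.

Local Lemma has_large_fiber0 : exists k, `[< has_large_fiber k >].
Proof.
exists 0; apply/asboolP => f _.
have e0P : delta_mx ord0 ord0 \in sphere R d.
  apply/mem_set; rewrite /sphere/= /enorm big_ord_recl big1 => [|i _].
    by rewrite addr0 mxE/= expr1n sqrtr1.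
  by rewrite mxE/= expr0n.
by exists (exist _ (delta_mx ord0 ord0) e0P); rewrite II0; exact: card_ge0.
Qed.

Let sq (x : 'rV[R]_d.+1) : 'rV[R]_d.+1 := \row_i x ord0 i ^+ 2.
Let nsq (x : 'rV[R]_d.+1) : 'rV[R]_d.+1 := (enorm (sq x))^-1 *: sq x.

Local Lemma enorm_sq_gt0 (x : sphere R d) : 0 < enorm (sq (val x)).
Proof.
rewrite /enorm sqrtr_gt0 lt_def sumr_ge0 => [|i _]; last exact: sqr_ge0.
rewrite andbT psumr_eq0 => [|i _]; last exact: sqr_ge0.
apply/negP => /allP sq0; have := sphere_sumsq x.
rewrite big1 => [/esym/eqP|i _]; first by rewrite oner_eq0.
by have := sq0 i (mem_index_enum i); rewrite mxE sqrf_eq0 => /eqP.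
Qed.

Local Lemma nsqP (x : sphere R d) : nsq (val x) \in sphere R d.
Proof.
apply/mem_set; rewrite /sphere/= {1}/enorm /nsq.
under eq_bigr do rewrite mxE exprMn.
rewrite -mulr_sumr sqrtrM ?sqr_ge0// sqrtr_sqr ger0_norm ?invr_ge0 ?sqrtr_ge0//.
by rewrite -/(enorm (sq (val x))) mulVf// gt_eqF// enorm_sq_gt0.
Qed.

Let fold (x : sphere R d) : sphere R d := exist _ (nsq (val x)) (nsqP x).

Local Lemma sq_continuous : continuous sq.
Proof.
move=> x A [P Px PA]; rewrite nbhs_simpl/=.
suff nP : \forall y \near x, forall i j, P i j (sq y i j).
  by apply: filterS nP => y Py; apply: PA => i j; exact: Py.
apply: (@filter_forall _ _ (fun i y => forall j, P i j (sq y i j)) (nbhs x) _) => i.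
apply: (@filter_forall _ _ (fun j y => P i j (sq y i j)) (nbhs x) _) => j.
have cij : {for x, continuous (fun y : 'rV[R]_d.+1 => y ord0 j ^+ 2)}.
  apply: (@continuous_comp _ _ _ (fun y : 'rV[R]_d.+1 => y ord0 j)
    (fun t : R => t ^+ 2)); first exact: coord_continuous.
  exact: exprn_continuous.
have := Px i j; rewrite mxE => /cij; apply: (@filterS _ (nbhs x)) => y /=.
by rewrite mxE.
Qed.

Local Lemma enorm_continuous : continuous (@enorm R d.+1).
Proof.
move=> x; apply: (@continuous_comp _ _ _
  (fun y : 'rV[R]_d.+1 => \sum_i y ord0 i ^+ 2) Num.sqrt); last first.
  exact: sqrt_continuous.
apply: (@cvg_big R _ _ _ _ _ _ (nbhs x) _ _ _ _) => [|i _]; first exact: add_continuous.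
apply: (@continuous_comp _ _ _ (fun y : 'rV[R]_d.+1 => y ord0 i)
  (fun t : R => t ^+ 2)); first exact: coord_continuous.
exact: exprn_continuous.
Qed.

Local Lemma fold_continuous : continuous fold.
Proof.
apply: continuous_comp_initial => x.
apply: (@continuous_comp _ _ _ (val : sphere R d -> _) nsq).
  exact: initial_continuous.
apply: continuousZ; last exact: sq_continuous.
apply: continuousV; first by rewrite gt_eqF// enorm_sq_gt0.
by apply: continuous_comp; [exact: sq_continuous|exact: enorm_continuous].
Qed.

Local Lemma fold_antipodal (x y : sphere R d) :
  antipodal R d x y -> fold x = fold y.
Proof.
move=> /orP[/eqP/val_inj->//|/eqP xy]; apply/val_inj => /=.
suff sqxy : sq (val x) = sq (val y) by rewrite /nsq sqxy.
by apply/rowP => i; rewrite !mxE xy mxE sqrrN.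
Qed.

Local Lemma fold_eq (x y : sphere R d) :
  fold x = fold y -> forall i, val x ord0 i ^+ 2 = val y ord0 i ^+ 2.
Proof.
move=> /(congr1 val)/=/rowP xy i.
set a := (enorm (sq (val x)))^-1; set b := (enorm (sq (val y)))^-1.
have xyE j : a * val x ord0 j ^+ 2 = b * val y ord0 j ^+ 2.
  by have := xy j; rewrite !mxE.
have ab : a = b.
  rewrite -[a]mulr1 -(sphere_sumsq x) -[b]mulr1 -(sphere_sumsq y) !mulr_sumr.
  exact: eq_bigr.
have a0 : a != 0 by rewrite invr_eq0 gt_eqF// enorm_sq_gt0.
by have := xyE i; rewrite -ab => /(mulfI a0).
Qed.

Local Lemma has_large_fiber_bounded k :
  `[< has_large_fiber k >] -> (k <= #|{ffun 'I_d.+1 -> bool}|)%N.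
Proof.
move=> /asboolP /(_ (fold \o repr)) [|x kx].
  apply: repr_comp_continuous; first exact: fold_continuous.
  by move=> a b /eqP/eqmodP ab; apply/eqP; exact: fold_antipodal.
rewrite -card_le_II; apply: card_le_trans kx _.
pose sgn (q : RP R d) : {ffun 'I_d.+1 -> bool} :=
  [ffun i => 0 <= val (repr q) ord0 i].
apply: inj_card_le; apply: unsquash; apply/injfunPex.
exists (fun q => enum_rank (sgn q) : nat) => [q _|q r]; first exact: ltn_ord.
rewrite !inE/= => qx rx /ord_inj/enum_rank_inj/ffunP qr.
rewrite -(reprK q) -(reprK r); congr (\pi _); apply/val_inj/rowP => i.
have := fold_eq (etrans qx (esym rx)) i.
move=> /eqP; rewrite eqf_sqr => /predU1P[//|/eqP qrN].
have := qr i; rewrite !ffunE qrN oppr_ge0.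
case: (ltgtP (val (repr r) ord0 i) 0) => // -> _.
by rewrite oppr0.
Qed.

Definition kappa : nat := ex_maxn has_large_fiber0 has_large_fiber_bounded.

Lemma kappaP :
  has_large_fiber kappa /\ forall k, has_large_fiber k -> (k <= kappa)%N.
Proof.
rewrite /kappa; case: ex_maxnP => i /asboolP iP imax; split=> // k kP.
exact/imax/asboolP.
Qed.

End kappa.
Arguments kappa : clear implicits.

Definition boundary (T : topologicalType) (A : set T) : set T :=
  closure A `\` interior A.

Definition segment (R : realType) (n : nat) (a b : 'rV[R]_n) : set 'rV[R]_n :=
  [set (1 - t) *: a + t *: b | t in `[0, 1]].

Definition line (R : realType) (n : nat) (p v : 'rV[R]_n) : set 'rV[R]_n :=
  [set p + t *: v | t in [set: R]].

Definition convex_body (R : realType) (n : nat) (K : set 'rV[R]_n) : Prop :=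
  [/\ convex_set K, compact K & interior K !=set0].

Definition strictly_convex_body (R : realType) (n : nat)
    (K : set 'rV[R]_n) : Prop :=
  convex_body K /\
  forall a b : 'rV[R]_n, a != b -> ~ (segment a b `<=` boundary K).

(* The length of a segment is its Euclidean diameter; the empty section gets
   length [-oo]. *)
Definition section_length (R : realType) (n : nat) (A : set 'rV[R]_n) : \bar R :=
  ereal_sup [set (enorm (x - y))%:E | x in A & y in A].

(* A direction is given by a nonzero vector [v]; lines parallel to it are the
   [line q v]. *)
Definition affine_diameter (R : realType) (n : nat)
    (K D : set 'rV[R]_n) : Prop :=
  exists p v : 'rV[R]_n,
    [/\ v != 0, D = K `&` line p v &
      forall q, (section_length (K `&` line q v) <= section_length D)%E].

(* Main.v *)
Require Import Defs.
From mathcomp Require Import all_boot all_order all_algebra.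
From mathcomp Require Import all_classical all_reals all_analysis.
From mathcomp Require Import ring lra.
Import Order.TTheory GRing.Theory Num.Theory.
Import numFieldNormedType.Exports.

(* By strict convexity each direction [v] has exactly one longest chord of [K],
   which depends continuously on [v]. The pairs (direction, point in the
   relative interior of its longest chord) form a line bundle over [RP^{d-1}],
   whose one-point compactification is [RP^d]; explicitly, [(s, v)] on the
   sphere goes to the point of the chord in the direction [v] at position [s].
   Sending such a pair to its point and collapsing the boundary of [K] gives a
   continuous map [RP^d -> K / boundary K = S^d]. The points of a fiber over an
   interior point of [K] are the distinct affine diameters through that point,
   while the fiber over the collapsed boundary is a singleton. *)

Local Open Scope classical_set_scope.
Local Open Scope ring_scope.
Local Open Scope card_scope.

Set Implicit Arguments.
Unset Strict Implicit.

(** * Convex sets and the distance to the complement *)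

Section ConvexSets.
Context {R : realType} {V : normedModType R}.
Implicit Types (K : set V) (a b p q v w x y : V) (s t r : R).

Lemma convex_set_combination K x y t : convex_set K -> K x -> K y ->
  0 <= t <= 1 -> K ((1 - t) *: x + t *: y).
Proof.
move=> cK Kx Ky /andP[t0 t1].
have := cK y x (Itv01 t0 t1); rewrite !inE => /(_ Ky Kx).
by rewrite /conv/= addrC.
Qed.

(** The homothety with centre [y] that takes the combination to [q] is continuous, so it takes
    nearby points into [K]; each of them is then a combination of a point of [K] and [y]. *)
Lemma interior_convex_combination K q y t : convex_set K -> K^° q -> K y ->
  0 <= t < 1 -> K^° ((1 - t) *: q + t *: y).
Proof.
move=> cK Kq Ky /andP[t0 t1].
have t1' : 1 - t != 0 by rewrite subr_eq0 gt_eqF.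
set c := (1 - t) *: q + t *: y.
have cvgz : (fun z => (1 - t)^-1 *: (z - t *: y)) @ c --> q.
  have -> : q = (1 - t)^-1 *: (c - t *: y).
    by rewrite /c addrK scalerA mulVf// scale1r.
  apply: cvgZ; first exact: cvg_cst.
  apply: (@cvgB _ _ _ (nbhs c)); [exact: cvg_id|exact: cvg_cst].
have := cvgz _ Kq; apply: (@filterS _ (nbhs c)) => z /= Kz.
have := convex_set_combination cK Kz Ky (t := t).
rewrite t0 ltW// => /(_ isT).
by rewrite scalerA mulfV// scale1r subrK.
Qed.

End ConvexSets.

(** The segment lies in [K] but not in the boundary, so it contains an interior point, at some
    parameter [r]. Any other inner point lies between that one and an endpoint, hence is interior by
    convexity. *)
Lemma strictly_convex_interior {R : realType} {n : nat} (K : set 'rV[R]_n)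
    (a b : 'rV[R]_n) (t : R) :
  strictly_convex_body K -> K a -> K b -> a != b -> 0 < t < 1 ->
  K^° ((1 - t) *: a + t *: b).
Proof.
move=> [[cK kK _] sK] Ka Kb ab /andP[t0 t1].
have [q [[r r01 <-] Kq]] : exists q, segment a b q /\ K^° q.
  apply: contrapT => nq; apply: (sK a b ab) => q sq; split.
    apply: subset_closure; case: sq => r + <-.
    by rewrite /= in_itv/=; exact: convex_set_combination.
  by move=> Kq; apply: nq; exists q.
move: r01; rewrite /= in_itv/= => /andP[r0 r1].
have [rt|tr] := ltP r t.
- have r1' : 1 - r != 0 by rewrite subr_eq0 gt_eqF// (lt_trans rt).
  have -> : (1 - t) *: a + t *: b =
      (1 - (t - r) / (1 - r)) *: ((1 - r) *: a + r *: b) +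
      ((t - r) / (1 - r)) *: b.
    by apply/rowP => i; rewrite !mxE; field.
  apply: interior_convex_combination => //.
  by apply/andP; split; [apply: divr_ge0; lra|rewrite ltr_pdivrMr; lra].
- have rn0 : r != 0 by rewrite gt_eqF//; lra.
  have -> : (1 - t) *: a + t *: b =
      (1 - (r - t) / r) *: ((1 - r) *: a + r *: b) + ((r - t) / r) *: a.
    by apply/rowP => i; rewrite !mxE; field.
  apply: interior_convex_combination => //.
  by apply/andP; split; [apply: divr_ge0; lra|rewrite ltr_pdivrMr; lra].
Qed.

Section DistanceToComplement.
Context {R : realType} {V : normedModType R} (K : set V).
Hypothesis nKc : ~` K !=set0.
Implicit Types (a b p q v w x y : V) (s t r : R).

(** It is positive exactly on the interior of [K], so it decides which points stay apart and which
    are collapsed to the pole of the sphere. *)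
Definition depth x : R := inf [set `|x - y| | y in ~` K].

Let has_inf_depth x : has_lbound [set `|x - y| | y in ~` K].
Proof. by exists 0 => _ [y _ <-]. Qed.

Lemma depth_le x y : ~ K y -> depth x <= `|x - y|.
Proof. by move=> Ky; apply: ge_inf => //; exists y. Qed.

Lemma le_depth x r : (forall y, ~ K y -> r <= `|x - y|) -> r <= depth x.
Proof.
move=> h; apply: lb_le_inf; first by case: nKc => y Ky; exists `|x - y|, y.
by move=> _ [y Ky <-]; exact: h.
Qed.

Lemma depth_ge0 x : 0 <= depth x.
Proof. exact: le_depth. Qed.

Lemma depth_lt x y : `|x - y| < depth x -> K y.
Proof. by move=> h; apply: contrapT => /(depth_le x); rewrite leNgt h. Qed.

Lemma depth_lipschitz x y : depth x - depth y <= `|x - y|.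
Proof.
rewrite lerBlDl -lerBlDr; apply: le_depth => z Kz.
rewrite lerBlDr (le_trans (depth_le x Kz))// [leRHS]addrC.
by rewrite -(subrKA y) ler_normD.
Qed.

Lemma depth_continuous : continuous depth.
Proof.
move=> x; apply/cvgrPdist_lt => e e0.
have := nbhsx_ballx x e e0; rewrite -ball_normE.
apply: (@filterS _ (nbhs x)) => y /= xy; rewrite ltr_norml.
have := depth_lipschitz x y; have := depth_lipschitz y x.
rewrite distrC => h1 h2; apply/andP; split; lra.
Qed.

Lemma depth_gt0 x : K^° x -> 0 < depth x.
Proof.
move=> /nbhs_ballP[e /= e0 xK]; rewrite (lt_le_trans e0)//.
apply: le_depth => y; apply: contra_notP => /negP; rewrite -ltNge => xy.
by apply: xK; rewrite -ball_normE.
Qed.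

Lemma depth_eq0 x : ~ K^° x -> depth x = 0.
Proof.
move=> Kx; apply/eqP; rewrite eq_le depth_ge0 andbT leNgt; apply/negP => d0.
apply: Kx; apply/nbhs_ballP; exists (depth x) => //= y.
by rewrite -ball_normE/=; exact: depth_lt.
Qed.

(** A point [z] at distance less than [r] from [c] is the same combination of [x] and [y] pushed by
    [depth x / r] and [depth y / r] times [z - c]. Each push is shorter than the depth, so the
    pushed points stay in [K]; the weighted shares add up to 1. *)
Lemma depth_concave x y t : convex_set K -> 0 < depth x -> 0 < depth y ->
  0 <= t <= 1 ->
  (1 - t) * depth x + t * depth y <= depth ((1 - t) *: x + t *: y).
Proof.
move=> cK dx dy t01; set r := _ + _; set c := _ + _.
have r0 : 0 < r.
  rewrite /r; case/andP: t01 => t0 t1; have [->|tn0] := eqVneq t 0.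
    by rewrite subr0 mul1r mul0r addr0.
  apply: ltr_wpDl; first by apply: mulr_ge0; [lra|exact: ltW].
  by apply: mulr_gt0; rewrite // lt_def tn0.
apply: le_depth => z; apply: contra_notP => /negP; rewrite -ltNge => cz.
have Kpush u : 0 < depth u -> K (u + (depth u / r) *: (z - c)).
  move=> du; apply: (@depth_lt u).
  rewrite opprD addNKr normrN normrZ ger0_norm ?divr_ge0 ?ltW//.
  by rewrite mulrAC ltr_pdivrMr// ltr_pM2l// distrC.
have := convex_set_combination cK (Kpush _ dx) (Kpush _ dy) t01.
congr (K _); rewrite -[z in RHS](subrK c); move: (z - c) => w.
rewrite !scalerDr !scalerA addrACA -scalerDl !mulrA -mulrDl mulfV ?gt_eqF//.
by rewrite scale1r addrC.
Qed.
End DistanceToComplement.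

(** * Longest chords *)

Lemma continuous_fst_comp (T U W : topologicalType) (g : T -> U * W) (x : T) :
  {for x, continuous g} -> {for x, continuous (fun y => (g y).1)}.
Proof. by move=> cg; apply: continuous_comp => //; exact: cvg_fst. Qed.

Lemma continuous_snd_comp (T U W : topologicalType) (g : T -> U * W) (x : T) :
  {for x, continuous g} -> {for x, continuous (fun y => (g y).2)}.
Proof. by move=> cg; apply: continuous_comp => //; exact: cvg_snd. Qed.

Section LongestChords.
Context {R : realType} {V : normedModType R} (K : set V).
Implicit Types (a b p q v w x y : V) (s t r : R).

(** The chord runs from [a] to [a + t *: v]. Chords parallel to [v] are compared by their length in
    units of [v], so no choice of norm enters. *)
Definition longest_chord v a t :=
  [/\ K a, K (a + t *: v) & forall b s, K b -> K (b + s *: v) -> s <= t].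

Lemma interior_push q v : K^° q -> exists2 e, 0 < e & K (q + e *: v).
Proof.
move=> Kq.
have cf : (fun e : R => q + e *: v) @ (0 : R) --> q.
  rewrite -[q in _ --> q]addr0 -[in _ --> _](scale0r v).
  apply: (@cvgD _ _ _ (nbhs (0 : R))); first exact: cvg_cst.
  by apply: (@cvgZr_tmp _ _ _ (nbhs (0 : R))); exact: cvg_id.
have /nbhs_ballP[e /= e0 eK] := cf _ Kq.
exists (e / 2); first by rewrite divr_gt0.
by apply: eK; rewrite -ball_normE/= sub0r normrN gtr0_norm; lra.
Qed.

Lemma longest_chordN v a t :
  longest_chord v a t -> longest_chord (- v) (a + t *: v) t.
Proof.
case=> Ka Kb mx; split=> //; first by rewrite scalerN addrK.
move=> b s Kb' Kbs; apply: (mx (b + s *: - v)) => //.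
by rewrite scalerN subrK.
Qed.

Lemma longest_chordZ v a t c :
  0 < c -> longest_chord v a t -> longest_chord (c *: v) a (t / c).
Proof.
move=> c0 [Ka Kb mx]; split=> //; first by rewrite scalerA divfK// gt_eqF.
by move=> b s Kb'; rewrite scalerA => /(mx _ _ Kb'); rewrite ler_pdivlMr.
Qed.

(** An interior initial point could be moved back along [v], giving a longer chord. *)
Lemma longest_chord_endpointl v a t : longest_chord v a t -> ~ K^° a.
Proof.
case=> Ka Kb mx /(interior_push (- v))[e e0 Ke].
have := mx _ (t + e) Ke.
rewrite scalerN scalerDl -addrA (addrCA (- _)) addNr addr0.
by move=> /(_ Kb); lra.
Qed.

Lemma longest_chord_endpointr v a t :
  longest_chord v a t -> ~ K^° (a + t *: v).
Proof. by move=> /longest_chordN/longest_chord_endpointl. Qed.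

Lemma longest_chord_gt0 v a t : K^° !=set0 -> longest_chord v a t -> 0 < t.
Proof.
move=> [q Kq] [_ _ mx]; have [e e0 Ke] := interior_push v Kq.
exact: lt_le_trans e0 (mx _ _ (interior_subset Kq) Ke).
Qed.

Hypothesis compactK : compact K.

Let closedK : closed K.
Proof. by apply: compact_closed => //; exact: norm_hausdorff. Qed.

Let norm_boundK : exists2 M, 0 < M & forall x, K x -> `|x| <= M.
Proof.
have [M [Mr KM]] := compact_bounded compactK.
exists (`|M| + 1) => [|x Kx]; first by rewrite ltr_wpDl.
by apply: KM => //; rewrite (le_lt_trans (ler_norm M))// ltrDl.
Qed.

Lemma chord_bound : exists2 B, 0 < B &
  forall a v t, K a -> K (a + t *: v) -> `|t *: v| <= B.
Proof.
have [M M0 KM] := norm_boundK; exists (M + M); first lra.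
move=> a v t Ka Kb; rewrite -(addKr a (t *: v)) addrC.
by rewrite (le_trans (ler_normB _ _))// lerD ?KM.
Qed.

Let chord_continuous v : continuous (fun z : V * R => z.1 + z.2 *: v).
Proof.
move=> z; apply: (@cvgD _ _ _ (nbhs z)); first exact: cvg_fst.
by apply: (@cvgZr_tmp _ _ _ (nbhs z)); exact: cvg_snd.
Qed.

(** The length attains its maximum on the compact set of pairs [(a, t)] with both ends in [K].
    Capping [t] by [B / |v|] excludes no chord, and negative lengths lose to the degenerate chord at
    [x]. *)
Lemma longest_chord_exists v :
  K !=set0 -> v != 0 -> exists z : V * R, longest_chord v z.1 z.2.
Proof.
move=> [x Kx] v0; have [B B0 KB] := chord_bound.
pose C := (K `*` `[0, B / `|v|]) `&` [set z : V * R | K (z.1 + z.2 *: v)].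
have compactC : compact C.
  apply: (@subclosed_compact _ _ (K `*` `[0, B / `|v|])).
  - apply: closedI.
      by apply: compact_closed; [exact: norm_hausdorff|
        apply: compact_setX => //; exact: segment_compact].
    by apply: (@closed_comp _ _ _ K) => // z _; exact: chord_continuous.
  - by apply: compact_setX => //; exact: segment_compact.
  - by move=> z [].
have tB a t : K a -> K (a + t *: v) -> t <= B / `|v|.
  move=> Ka Kb; rewrite ler_pdivlMr ?normr_gt0//.
  by rewrite (le_trans _ (KB _ _ _ Ka Kb))// normrZ ler_wpM2r// ler_norm.
have C0 : C (x, 0).
  split => /=; last by rewrite scale0r addr0.
  by split=> //=; rewrite in_itv/= lexx divr_ge0// ltW.
have [|z zC zmax] := @compact_EVT_max _ R snd C (ex_intro _ _ C0) compactC.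
  apply: continuous_subspaceT; move=> z; exact: cvg_snd.
have [[Kz _] Kz'] := set_mem zC.
exists z; split=> // b s Kb Ks.
have z0 : 0 <= z.2 by apply: (zmax (x, 0)); exact/mem_set.
have [s0|s0] := ltP s 0; first by rewrite (le_trans (ltW s0)).
apply: (zmax (b, s)); apply/mem_set; split => //; split => //=.
by rewrite in_itv/= s0 (tB b).
Qed.

Hypothesis convexK : convex_set K.
Hypothesis interiorK : K^° !=set0.

(** Lower semicontinuity of the maximal length. The homothety of ratio [r / t] centred at an
    interior point [q] turns the chord into one of length [r] whose far end is interior, so that end
    stays in [K] when [v] moves slightly. *)
Lemma longer_chord_near v a t r : longest_chord v a t -> 0 <= r < t ->
  \forall w \near v, forall b s, longest_chord w b s -> r <= s.
Proof.
move=> lc /andP[r0 rt]; have t0 := le_lt_trans r0 rt.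
case: lc => Ka Kb _; have [q Kq] := interiorK.
pose c := (1 - r / t) *: q + (r / t) *: a.
have rt01 : 0 <= r / t < 1.
  by rewrite divr_ge0 ?(ltW t0)//= ltr_pdivrMr// mul1r.
have Kc : K c.
  by apply: interior_subset; exact: interior_convex_combination.
have Kcv : K^° (c + r *: v).
  have -> : c + r *: v = (1 - r / t) *: q + (r / t) *: (a + t *: v).
    by rewrite /c scalerDr scalerA divfK ?gt_eqF// addrA.
  exact: interior_convex_combination.
have cf : (fun w => c + r *: w) @ v --> c + r *: v.
  apply: (@cvgD _ _ _ (nbhs v)); first exact: cvg_cst.
  by apply: (@cvgZl_tmp _ _ _ (nbhs v)); exact: cvg_id.
have := cf _ Kcv; apply: (@filterS _ (nbhs v)) => w /= Kw b s [_ _]; apply.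
  exact: Kc.
exact: Kw.
Qed.

Hypothesis midK : forall a b, K a -> K b -> a != b ->
  K^° ((1 - 2^-1) *: a + 2^-1 *: b).

(** Two distinct longest chords have equal lengths; the chord joining the midpoints of their initial
    and final points has the same length and an interior far end, so it can be prolonged. *)
Lemma longest_chord_unique v a t b s :
  longest_chord v a t -> longest_chord v b s -> a = b /\ t = s.
Proof.
move=> lc lc'; have ts : t = s.
  case: lc lc' => Ka Kat mx [Kb Kbs mx'].
  by apply/eqP; rewrite eq_le (mx' a)// (mx b).
split=> //; apply/eqP/negPn/negP => ab; rewrite -{}ts in lc'.
case: lc lc' => Ka Kat mx [Kb Kbt _].
have Kat' := midK Kat Kbt.
have abt : a + t *: v != b + t *: v by rewrite (inj_eq (addIr _)).
have [e e0 Ke] := interior_push v (Kat' abt).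
have := mx _ (t + e) (interior_subset (midK Ka Kb ab)).
have -> : (1 - 2^-1) *: a + 2^-1 *: b + (t + e) *: v =
  (1 - 2^-1) *: (a + t *: v) + 2^-1 *: (b + t *: v) + e *: v.
  rewrite !scalerDr [in RHS]addrACA -(scalerDl (t *: v)) subrK scale1r.
  by rewrite (scalerDl v) addrA.
by move=> /(_ Ke); lra.
Qed.

(** By compactness of [K] times [[0, T]] it is enough to treat directions near [v] and pairs near a
    fixed [z]. Either [z] is the longest chord for [v], hence equals [f v], or its far end is
    outside [K], or it is a shorter chord; the last two persist nearby and exclude longest
    chords. *)
Lemma longest_chord_continuous (f : V -> V * R) v : v != 0 ->
  (forall w, w != 0 -> longest_chord w (f w).1 (f w).2) ->
  {for v, continuous f}.
Proof.
move=> v0 fP U fvU.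
have [B B0 KB] := chord_bound.
(* This bounds the length of the longest chord in every direction [w] of norm above [|v| / 2]. *)
set T := B / (`|v| / 2).
have v20 : 0 < `|v| / 2 by rewrite divr_gt0 ?normr_gt0.
have nearv : \forall w \near v, `|v| / 2 < `|w|.
  have := nbhsx_ballx v _ v20; rewrite -ball_normE.
  apply: (@filterS _ (nbhs v)) => w /= vw.
  have := ler_normD (v - w) w; rewrite subrK; lra.
have cKT : compact (K `*` `[0, T]).
  by apply: compact_setX => //; exact: segment_compact.
have /compact_near_coveringP/(_ _ (nbhs v)
  (fun w z => longest_chord w z.1 z.2 -> U z)) := cKT.
have Uv z : longest_chord v z.1 z.2 -> nbhs z U.
  move=> lz; suff -> : z = f v by exact: fvU.
  have [h1 h2] := longest_chord_unique lz (fP _ v0).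
  by rewrite (surjective_pairing z) h1 h2 -surjective_pairing.
move=> /(_ (nbhs_filter v)) h.
have {}h : \forall w \near v,
    K `*` `[0, T] `<=` (fun z => longest_chord w z.1 z.2 -> U z).
  apply: h => z [Kz /=]; rewrite in_itv/= => /andP[z0 zT].
  have [lz|nlz] := pselect (longest_chord v z.1 z.2).
    exists (U, setT); first by split => //=; [exact: Uv|exact: filterT].
    by move=> [y w] [/= Uy _].
  have [Kz'|Kz'] := pselect (K (z.1 + z.2 *: v)); last first.
    have cf : {for (z, v),
        continuous (fun u : V * R * V => u.1.1 + u.1.2 *: u.2)}.
      have c1 : {for (z, v), continuous (fun u : V * R * V => u.1)}.
        exact: cvg_fst.
      apply: continuousD.
        exact: continuous_fst_comp c1.
      apply: continuousZ; last exact: cvg_snd.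
      exact: continuous_snd_comp c1.
    have : nbhs (z.1 + z.2 *: v) (~` K).
      by apply: open_nbhs_nbhs; split=> //; exact: closed_openC.
    by move=> /cf; apply: (@filterS _ (nbhs (z, v))) => -[y w] /= nK [].
  have [Kf Kf' fmax] := fP _ v0.
  have zf : z.2 < (f v).2.
    rewrite lt_neqAle (fmax _ _ Kz Kz') andbT; apply/eqP => zf; apply: nlz.
    by split=> // b s Kb Ks; rewrite zf; exact: fmax Ks.
  (* Pairs near [z] have length below [r], while longest chords in directions near [v] have length
     at least [r]. *)
  set r := (z.2 + (f v).2) / 2.
  have zr : z.2 < r by rewrite /r; lra.
  exists ([set y : V * R | y.2 < r],
          [set w | forall b s, longest_chord w b s -> r <= s]).
    split => /=.
      have : nbhs z.2 [set s | s < r] by exact: lt_nbhsl.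
      by move=> /(@cvg_snd _ _ (nbhs z.1) (nbhs z.2)).
    by apply: (longer_chord_near (fP _ v0)); rewrite /r; apply/andP; split; lra.
  by move=> [y w] [/= yr wr] /wr; rewrite leNgt yr.
have : \forall w \near v, (`|v| / 2 < `|w|) /\
    K `*` `[0, T] `<=` (fun z => longest_chord w z.1 z.2 -> U z).
  exact: filterI.
apply: (@filterS _ (nbhs v)) => w [vw hw].
have w0 : w != 0 by rewrite -normr_gt0 (lt_trans v20).
have lw := fP _ w0; apply: hw => //; split=> /=; first by case: lw.
have t0 := longest_chord_gt0 interiorK lw.
rewrite in_itv/= ltW//= /T ler_pdivlMr//.
case: lw => Kf Kf' _; rewrite (le_trans _ (KB _ _ _ Kf Kf'))//.
by rewrite normrZ gtr0_norm// ler_wpM2l// ltW.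
Qed.
End LongestChords.

(** * Collapsing the complement of a set to a point of the sphere *)

Section EuclideanNorm.
Context {R : realType} {n : nat}.
Implicit Types (x y : 'rV[R]_n).

Definition sumsq x : R := \sum_i x ord0 i ^+ 2.

Lemma sumsqE x : sumsq x = \sum_i x ord0 i ^+ 2.
Proof. by []. Qed.

Lemma sumsq_ge0 x : 0 <= sumsq x.
Proof. by apply: sumr_ge0 => i _; exact: sqr_ge0. Qed.

Lemma sumsqZ (c : R) x : sumsq (c *: x) = c ^+ 2 * sumsq x.
Proof.
by rewrite /sumsq mulr_sumr; apply: eq_bigr => i _; rewrite mxE exprMn.
Qed.

Lemma enormZ (c : R) x : enorm (c *: x) = `|c| * enorm x.
Proof.
by rewrite /enorm -/(sumsq _) sumsqZ sqrtrM ?sqr_ge0// sqrtr_sqr.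
Qed.

Lemma norm_sqr_le_sumsq x : `|x| ^+ 2 <= sumsq x.
Proof.
have [->|x0] := eqVneq `|x| 0; first by rewrite expr0n sumsq_ge0.
have [[i j] /= xij] := mx_norm_neq0 x0.
rewrite [X in X ^+ 2]/Num.norm/= xij (ord1 i) /sumsq (bigD1 j)//=.
rewrite real_normK ?num_real//.
by rewrite lerDl sumr_ge0// => k _; exact: sqr_ge0.
Qed.

Lemma norm_coord_le x i : `|x ord0 i| <= `|x|.
Proof.
rewrite [leRHS]/Num.norm/= mx_normrE.
exact: (le_bigmax _ (fun ij : 'I_1 * 'I_n => `|x ij.1 ij.2|) (ord0, i)).
Qed.

Lemma sumsq_eq0 x : sumsq x = 0 -> x = 0.
Proof.
move=> x0; apply/eqP; rewrite -normr_eq0 -sqrf_eq0 eq_le sqr_ge0 andbT.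
by rewrite -x0 norm_sqr_le_sumsq.
Qed.

Lemma row_continuous (T : topologicalType) (g : T -> 'rV[R]_n) (z : T) :
  (forall i, {for z, continuous (fun u => g u ord0 i)}) ->
  {for z, continuous g}.
Proof.
move=> cg A [P Pz PA]; rewrite nbhs_simpl/=.
suff nP : \forall u \near z, forall i j, P i j (g u i j).
  by apply: filterS nP => u Pu; apply: PA => i j; exact: Pu.
apply: (@filter_forall _ _ (fun i u => forall j, P i j (g u i j))
  (nbhs z) _) => i.
apply: (@filter_forall _ _ (fun j u => P i j (g u i j)) (nbhs z) _) => j.
by rewrite (ord1 i); apply: cg; exact: Pz.
Qed.

Lemma sumsq_continuous : continuous sumsq.
Proof.
move=> x; apply: (@cvg_big R _ _ _ _ _ _ (nbhs x) _ _ _ _) => [|i _].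
  exact: add_continuous.
apply: (@continuous_comp _ _ _ (fun y : 'rV[R]_n => y ord0 i)
  (fun t : R => t ^+ 2)); first exact: coord_continuous.
exact: exprn_continuous.
Qed.

End EuclideanNorm.

Lemma sphereP (R : realType) (n : nat) (x : 'rV[R]_n.+1) :
  sphere R n x <-> sumsq x = 1.
Proof.
rewrite /sphere/= /enorm -/(sumsq x); split=> [x1|->]; last exact: sqrtr1.
by rewrite -[LHS]sqr_sqrtr ?sumsq_ge0// x1 expr1n.
Qed.

#[local] Opaque sumsq.

Section SphereMap.
Context {R : realType} {n : nat} (dlt : 'rV[R]_n -> R) (p : 'rV[R]_n).
Hypothesis dlt_ge0 : forall x, 0 <= dlt x.
Hypothesis dlt_lipschitz : forall x y, dlt x - dlt y <= `|x - y|.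
Hypothesis dltp_gt0 : 0 < dlt p.
Implicit Types (x y : 'rV[R]_n).

Let den x := sumsq (x - p) + dlt x ^+ 2.

(* The inverse stereographic projection, from the pole [delta_mx ord0 ord0], of
   [(x - p) / dlt x]; clearing denominators extends it to [dlt x = 0], which is
   sent to the pole. *)
Definition sphere_map x : 'rV[R]_n.+1 :=
  \row_i ((if unlift ord0 i is Some j
           then 2 * dlt x * (x - p) ord0 j
           else sumsq (x - p) - dlt x ^+ 2) / den x).

Let sphere_map0 x :
  sphere_map x ord0 ord0 = (sumsq (x - p) - dlt x ^+ 2) / den x.
Proof. by rewrite mxE unlift_none. Qed.

Let sphere_mapS x j : sphere_map x ord0 (lift ord0 j) =
  2 * dlt x * (x - p) ord0 j / den x.
Proof. by rewrite mxE liftK. Qed.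

Let dltp_le x : dlt p <= `|x - p| + dlt x.
Proof. by have := dlt_lipschitz p x; rewrite distrC lerBlDr. Qed.

(** With [N] the distance to [p], [D = dlt x] and [P = dlt p], the Lipschitz bound gives
    [P <= N + D], so [D * P <= D * N + D ^+ 2 <= 2 * (N ^+ 2 + D ^+ 2)]. The next bound is the same
    with [N] as the factor. *)
Let den_ge_dlt x : dlt x * (dlt p / 2) <= den x.
Proof.
have h1 := norm_sqr_le_sumsq (x - p); have h2 := dltp_le x.
have h3 := dlt_ge0 x; have h4 := normr_ge0 (x - p).
have P0 := dltp_gt0.
rewrite /den; set D := dlt x in h2 h3 *; set P := dlt p in P0 h2 *.
set N := `|x - p| in h1 h2 h4.
by have := ler_wpM2l h3 h2; have := sqr_ge0 (N - D); nra.
Qed.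

Let den_ge_norm x : `|x - p| * (dlt p / 2) <= den x.
Proof.
have h1 := norm_sqr_le_sumsq (x - p); have h2 := dltp_le x.
have h3 := dlt_ge0 x; have h4 := normr_ge0 (x - p).
have P0 := dltp_gt0.
rewrite /den; set D := dlt x in h2 h3 *; set P := dlt p in P0 h2 *.
set N := `|x - p| in h1 h2 h4 *.
by have := ler_wpM2l h4 h2; have := sqr_ge0 (N - D); nra.
Qed.

Let den_gt0 x : 0 < den x.
Proof.
rewrite lt_def addr_ge0 ?sumsq_ge0 ?sqr_ge0// andbT.
apply/negP => /eqP d0; have h2 := dltp_le x; have P0 := dltp_gt0.
have := den_ge_dlt x; have := den_ge_norm x; rewrite d0.
by rewrite !pmulr_lle0 ?divr_gt0// => ? ?; lra.
Qed.

Lemma sphere_map_sphere x : sphere R n (sphere_map x).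
Proof.
apply/sphereP; rewrite sumsqE big_ord_recl sphere_map0.
under eq_bigr do rewrite sphere_mapS mulrAC exprMn.
rewrite -mulr_sumr -sumsqE.
by have := den_gt0 x; rewrite /den => /lt0r_neq0 d0; field.
Qed.

(** Each coordinate differs from that of the pole by at most [2 * dlt x] times [|x - p| / den x] or
    [dlt x / den x], and both quotients are at most [2 / dlt p]. *)
Lemma sphere_map_dist_pole x i :
  `|sphere_map x ord0 i - (i == ord0)%:R| <= 4 / dlt p * dlt x.
Proof.
have d0 := den_gt0 x; have h3 := dlt_ge0 x.
have -> : 4 / dlt p * dlt x = 2 * dlt x / (dlt p / 2).
  by have := lt0r_neq0 dltp_gt0 => P0; field.
have [j ->|->] := unliftP ord0 i.
- rewrite sphere_mapS subr0 -mulrA normrM (ger0_norm (mulr_ge0 _ h3))//.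
  rewrite ler_wpM2l ?mulr_ge0// normrM normfV (gtr0_norm d0).
  rewrite ler_pdivrMr// ler_pdivlMl ?divr_gt0//.
  rewrite (le_trans _ (den_ge_norm x))// mulrC ler_wpM2r//.
    by rewrite divr_ge0// ltW.
  exact: norm_coord_le.
- rewrite sphere_map0 eqxx.
  have -> : (sumsq (x - p) - dlt x ^+ 2) / den x - 1 =
      - (2 * dlt x * (dlt x / den x)).
    by have := lt0r_neq0 d0; rewrite /den => P0; field.
  rewrite normrN ger0_norm ?mulr_ge0 ?invr_ge0 ?(ltW d0)//.
  rewrite ler_wpM2l ?mulr_ge0// ler_pdivrMr// ler_pdivlMl ?divr_gt0//.
  by rewrite mulrC.
Qed.

Lemma sphere_map_pole x : dlt x = 0 -> sphere_map x = delta_mx ord0 ord0.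
Proof.
move=> d0; apply/rowP => i; have := sphere_map_dist_pole x i.
by rewrite d0 mulr0 normr_le0 subr_eq0 => /eqP ->; rewrite [RHS]mxE eqxx.
Qed.

(** Equal images give [(x - p) / dlt x = (y - p) / dlt y], so [x] and [y] lie on one ray from [p].
    The hypothesis on [dlt] makes the ratio of the distance from [p] to [dlt] strictly increasing
    along such a ray. *)
Lemma sphere_map_inj x y :
  (forall a r, 0 < dlt a -> 0 <= r < 1 ->
     r * dlt a < dlt ((1 - r) *: p + r *: a)) ->
  0 < dlt x -> sphere_map x = sphere_map y -> x = y.
Proof.
move=> dlt_star dx xy.
have Dx := lt0r_neq0 (den_gt0 x); have Dy := lt0r_neq0 (den_gt0 y).
(* If [dlt y = 0], both images are the pole, whose first coordinate 1 forces [dlt x = 0]. *)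
have dy : 0 < dlt y.
  rewrite lt_def dlt_ge0// andbT; apply/eqP => dy0.
  have := sphere_map0 x; rewrite xy sphere_map_pole// mxE eqxx.
  move=> /(congr1 (fun s => s * den x)); rewrite divfK// mul1r /den.
  by have := exprn_gt0 2 dx; lra.
(* This quotient is half of 1 minus the first coordinate of the image. *)
have e2 : dlt x ^+ 2 / den x = dlt y ^+ 2 / den y.
  have := sphere_map0 x; rewrite xy sphere_map0 => e0.
  have ex : dlt x ^+ 2 / den x =
      (1 - (sumsq (x - p) - dlt x ^+ 2) / den x) / 2.
    by rewrite /den in Dx *; field.
  rewrite ex -e0; by rewrite /den in Dy *; field.
have ej j : dlt y * (x - p) ord0 j = dlt x * (y - p) ord0 j.
  have := sphere_mapS x j; rewrite xy sphere_mapS => e1.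
  have n0 : dlt x ^+ 2 / den x != 0.
    by rewrite mulf_neq0 ?invr_neq0// expf_neq0// gt_eqF.
  apply: (mulfI n0); rewrite [in RHS]e2.
  transitivity (dlt x * dlt y / 2 *
      (2 * dlt x * (x - p) ord0 j / den x)); first by field.
  by rewrite -e1; field.
have exy : x - p = (dlt x / dlt y) *: (y - p).
  apply/rowP => j; rewrite [RHS]mxE mulrAC -ej mulrAC mulfV ?mul1r//.
  by rewrite gt_eqF.
have ray a b r : 0 < dlt a -> 0 <= r < 1 -> b - p = r *: (a - p) ->
    r * dlt a < dlt b.
  move=> da r01 ba; have := dlt_star a r da r01.
  suff -> : (1 - r) *: p + r *: a = b by [].
  by rewrite -[b](subrK p) ba; apply/rowP => i; rewrite !mxE; ring.
have [xy1|yx1|eq1] := ltgtP (dlt x) (dlt y).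
- have := ray y x _ dy _ exy; rewrite divfK ?gt_eqF// ltxx => h.
  by suff : false by []; apply: h; rewrite divr_ge0 ?ltW//= ltr_pdivrMr// mul1r.
- have eyx : y - p = (dlt y / dlt x) *: (x - p).
    by rewrite exy scalerA mulrA divfK ?gt_eqF// mulfV ?gt_eqF// scale1r.
  have := ray x y _ dx _ eyx; rewrite divfK ?gt_eqF// ltxx => h.
  by suff : false by []; apply: h; rewrite divr_ge0 ?ltW//= ltr_pdivrMr// mul1r.
- move: exy; rewrite eq1 mulfV ?gt_eqF// scale1r.
  by move/addIr.
Qed.

Lemma sphere_map_continuous : continuous dlt -> continuous sphere_map.
Proof.
move=> dlt_cont x; apply: row_continuous => i.
have cd : {for x, continuous dlt} by exact: dlt_cont.
have cx : {for x, continuous (fun y => y - p)}.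
  by apply: continuousB; [exact: cvg_id|exact: cst_continuous].
have cs : {for x, continuous (fun y => sumsq (y - p))}.
  by apply: continuous_comp => //; exact: sumsq_continuous.
have cd2 : {for x, continuous (fun y => dlt y ^+ 2)}.
  apply: (@continuous_comp _ _ _ dlt (fun t : R => t ^+ 2)) => //.
  exact: exprn_continuous.
have cden : {for x, continuous (fun y => (den y)^-1)}.
  apply: continuousV; first by rewrite gt_eqF.
  exact: continuousD.
have -> : (fun y => sphere_map y ord0 i) =
  (fun y => (if unlift ord0 i is Some j then 2 * dlt y * (y - p) ord0 j
    else sumsq (y - p) - dlt y ^+ 2) * (den y)^-1).
  by apply/funext => y; rewrite mxE.
apply: continuousM => //; case: unlift => [j|]; last exact: continuousB.
apply: continuousM.
  by apply: continuousM => //; exact: cst_continuous.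
apply: (@continuous_comp _ _ _ (fun y => y - p)
  (fun y : 'rV[R]_n => y ord0 j)) => //.
exact: coord_continuous.
Qed.
End SphereMap.

(** * The map from the projective space to the sphere *)

Lemma continuous_modulus (R : realType) (T : topologicalType) (g h : T -> R)
    (x : T) : {for x, continuous g} -> g x = 0 ->
  (forall y, `|h x - h y| <= g y) -> {for x, continuous h}.
Proof.
move=> cg gx gh; apply/cvgrPdist_lt => e e0.
move: cg => /cvgrPdist_lt/(_ _ e0); apply: filterS => y.
by rewrite gx sub0r normrN => /(le_lt_trans (ler_norm _)); exact: le_lt_trans.
Qed.

Lemma row_neq0 (R : realType) (n : nat) : (0 < n)%N ->
  exists v : 'rV[R]_n, v != 0.
Proof.
move=> n_gt0; exists (const_mx 1); apply/eqP => /rowP/(_ (Ordinal n_gt0)).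
by rewrite !mxE => /eqP; rewrite oner_eq0.
Qed.

Section ChordMap.
Context {R : realType} {n : nat} (K : set 'rV[R]_n).
Hypothesis bodyK : strictly_convex_body K.
Hypothesis n_gt0 : (0 < n)%N.
Implicit Types (a b p v : 'rV[R]_n) (z : 'rV[R]_n.+1) (s t : R).

Lemma strictly_convex_body_convex : convex_set K.
Proof. by case: bodyK => -[]. Qed.

Lemma strictly_convex_body_compact : compact K.
Proof. by case: bodyK => -[]. Qed.

Lemma strictly_convex_body_interior : K^° !=set0.
Proof. by case: bodyK => -[]. Qed.

Lemma strictly_convex_body_chord v :
  v != 0 -> exists z : 'rV[R]_n * R, longest_chord K v z.1 z.2.
Proof.
apply: longest_chord_exists; first exact: strictly_convex_body_compact.
have [q Kq] := strictly_convex_body_interior; exists q.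
exact: interior_subset.
Qed.

(** A longest chord prolonged by one unit leaves [K]. The infimum defining [depth] is therefore over
    a nonempty set. *)
Lemma strictly_convex_bodyC : ~` K !=set0.
Proof.
have [v0 v0_neq0] := @row_neq0 R n n_gt0.
have [[a t] /= [Ka _ mx]] := strictly_convex_body_chord v0_neq0.
exists (a + (t + 1) *: v0) => /(mx _ _ Ka).
by rewrite gerDl ler10.
Qed.

Lemma strictly_convex_midpoint a b : K a -> K b -> a != b ->
  K^° ((1 - 2^-1) *: a + 2^-1 *: b).
Proof.
move=> Ka Kb ab; apply: strictly_convex_interior => //.
by apply/andP; split; lra.
Qed.

Lemma chord_unique v a t b s :
  longest_chord K v a t -> longest_chord K v b s -> a = b /\ t = s.
Proof. exact: longest_chord_unique strictly_convex_midpoint _ _ _ _ _. Qed.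

Lemma chord_interior v a t s : v != 0 -> longest_chord K v a t -> 0 < s < 1 ->
  K^° (a + (s * t) *: v).
Proof.
move=> v_neq0 lc s01.
have t0 := longest_chord_gt0 strictly_convex_body_interior lc.
have -> : a + (s * t) *: v = (1 - s) *: a + s *: (a + t *: v).
  by apply/rowP => i; rewrite !mxE; ring.
case: lc => Ka Kb _; apply: strictly_convex_interior => //.
by rewrite -subr_eq0 opprD addNKr oppr_eq0 scaler_eq0 negb_or gt_eqF.
Qed.

(** Two points of a parallel section differ by a multiple of [v] whose coefficient is at most [t] in
    either order, so the Euclidean length of that section is at most that of the chord. *)
Lemma chord_affine_diameter v a t : v != 0 -> longest_chord K v a t ->
  affine_diameter K (K `&` line a v).
Proof.
move=> v_neq0 [Ka Kb mx]; exists a, v; split=> // q.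
apply: (@le_trans _ _ (enorm (a - (a + t *: v)))%:E); last first.
  apply: ereal_sup_ubound => /=.
  exists a; first by split=> //; exists 0; rewrite //= scale0r addr0.
  by exists (a + t *: v) => //; split=> //; exists t.
apply: ge_ereal_sup => _ [x [Kx [r _ rx]] [y [Ky [s _ sy]] <-]].
have xy : y = x + (s - r) *: v.
  by rewrite -rx -sy; apply/rowP => i; rewrite !mxE; ring.
have yx : x = y + (r - s) *: v.
  by rewrite xy; apply/rowP => i; rewrite !mxE; ring.
have h1 : s - r <= t by apply: (mx x); rewrite // -xy.
have h2 : r - s <= t by apply: (mx y); rewrite // -yx.
rewrite lee_fin opprD addNKr -scaleNr enormZ.
have -> : x - y = (r - s) *: v by rewrite {1}yx addrAC subrr add0r.
rewrite enormZ ler_wpM2r ?sqrtr_ge0// normrN (ger0_norm (x := t)); last lra.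
by rewrite ler_norml; apply/andP; split; lra.
Qed.

(* [f v] stores a longest chord in the direction [v]: its initial point and its
   length in units of [v]. At [v = 0] the chord is a single boundary point. *)
Definition chord_selection (f : 'rV[R]_n -> 'rV[R]_n * R) := forall v,
  [/\ v != 0 -> longest_chord K v (f v).1 (f v).2,
      K (f v).1 /\ K ((f v).1 + (f v).2 *: v),
      ~ K^° (f v).1 & ~ K^° ((f v).1 + (f v).2 *: v)].

Lemma chord_selection_exists : exists f, chord_selection f.
Proof.
suff /choice[f fP] : forall v, exists z : 'rV[R]_n * R,
  [/\ v != 0 -> longest_chord K v z.1 z.2, K z.1 /\ K (z.1 + z.2 *: v),
      ~ K^° z.1 & ~ K^° (z.1 + z.2 *: v)] by exists f.
move=> v; have [->|v_neq0] := eqVneq v 0.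
  have [v0 v0_neq0] := @row_neq0 R n n_gt0.
  have [[a t] /= lc] := strictly_convex_body_chord v0_neq0.
  have nKa := longest_chord_endpointl lc; case: lc => Ka _ _.
  by exists (a, 0); rewrite /= scaler0 addr0; split=> //; rewrite eqxx.
have [z lc] := strictly_convex_body_chord v_neq0.
exists z; split=> //; first by case: lc.
- exact: longest_chord_endpointl lc.
- exact: longest_chord_endpointr lc.
Qed.

Variable f : 'rV[R]_n -> 'rV[R]_n * R.
Hypothesis fP : chord_selection f.

Lemma chord_selection_continuous v : v != 0 -> {for v, continuous f}.
Proof.
move=> v_neq0; apply: (longest_chord_continuous strictly_convex_body_compact
  strictly_convex_body_convex strictly_convex_body_interior
  strictly_convex_midpoint v_neq0).
by move=> w w0; case: (fP w) => /(_ w0).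
Qed.

(* A point [z = (s, v)] of the sphere parametrizes the chord in the direction
   [v] by [s], which runs over ]-1, 1[ from one endpoint to the other. *)
Definition chord_point z : 'rV[R]_n :=
  (f (col' ord0 z)).1 +
  ((1 + z ord0 ord0) / 2 * (f (col' ord0 z)).2) *: col' ord0 z.

Lemma sumsq_split z : sumsq z = z ord0 ord0 ^+ 2 + sumsq (col' ord0 z).
Proof.
rewrite !sumsqE big_ord_recl; congr (_ + _).
by apply: eq_bigr => i _; rewrite mxE.
Qed.

Lemma sphere_coord0_lt1 z : sphere R n z -> col' ord0 z != 0 ->
  0 < (1 + z ord0 ord0) / 2 < 1.
Proof.
move=> /sphereP; rewrite sumsq_split => zS /negP v_neq0.
have : 0 < sumsq (col' ord0 z).
  by rewrite lt_def sumsq_ge0 andbT; apply/negP => /eqP/sumsq_eq0/eqP.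
by move=> ?; apply/andP; split; nra.
Qed.

Lemma chord_point_interior z : sphere R n z -> col' ord0 z != 0 ->
  K^° (chord_point z).
Proof.
move=> zS v_neq0; case: (fP (col' ord0 z)) => /(_ v_neq0) lc _ _ _.
by apply: chord_interior => //; exact: sphere_coord0_lt1.
Qed.

Lemma col'N z : col' ord0 (- z) = - col' ord0 z.
Proof. by apply/rowP => i; rewrite !mxE. Qed.

Lemma sphereN z : sphere R n z -> sphere R n (- z).
Proof.
move=> /sphereP zS; apply/sphereP.
by rewrite -scaleN1r sumsqZ sqrrN expr1n mul1r.
Qed.

(** By uniqueness the chord for [- v] is the chord for [v] reversed, and [- s] is the position [s]
    read from the other end. *)
Lemma chord_pointN z : col' ord0 z != 0 -> chord_point (- z) = chord_point z.
Proof.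
move=> v_neq0; rewrite /chord_point col'N; set v := col' ord0 z.
have vN : - v != 0 by rewrite oppr_eq0.
case: (fP (- v)) => /(_ vN) lcN _ _ _; case: (fP v) => /(_ v_neq0) lc _ _ _.
have [-> ->] := chord_unique lcN (longest_chordN lc).
by apply/rowP => i; rewrite !mxE; field.
Qed.

Lemma col'_continuous : continuous (fun z => col' ord0 z).
Proof.
move=> z; apply: row_continuous => i.
rewrite (_ : (fun y => _) = fun y : 'rV[R]_n.+1 => y ord0 (lift ord0 i)).
  exact: coord_continuous.
by apply/funext => y; rewrite mxE.
Qed.

Lemma chord_point_continuous z : col' ord0 z != 0 ->
  {for z, continuous chord_point}.
Proof.
move=> v_neq0.
have cc : {for z, continuous (fun y => col' ord0 y)} by exact: col'_continuous.
have cfc : {for z, continuous (fun y => f (col' ord0 y))}.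
  by apply: continuous_comp => //; exact: chord_selection_continuous.
apply: continuousD.
  exact: continuous_fst_comp cfc.
apply: continuousZ; last exact: cc.
apply: continuousM; last first.
  exact: continuous_snd_comp cfc.
apply: continuousM; last exact: cst_continuous.
by apply: continuousD; [exact: cst_continuous|exact: coord_continuous].
Qed.

(** The nearer endpoint, chosen by the sign of [s], has depth 0 and lies at distance [|1 - |s|| / 2]
    times the length of the chord; [depth] is 1-Lipschitz. *)
Lemma chord_point_depth : exists2 B, 0 < B &
  forall z, depth K (chord_point z) <= B * `|1 - `|z ord0 ord0| |.
Proof.
have [B B0 KB] := chord_bound strictly_convex_body_compact.
exists B => // z; rewrite /chord_point.
set v := col' ord0 z; set s := z ord0 ord0.
have [_ [Ka Kb] na nb] := fP v.
have vB := KB _ _ _ Ka Kb.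
have dB x y : ~ K^° y -> depth K x <= `|x - y|.
  move=> ny; rewrite -[leLHS]subr0 -(depth_eq0 strictly_convex_bodyC ny).
  exact: (depth_lipschitz strictly_convex_bodyC).
have [s0|s0] := leP 0 s.
- rewrite (ger0_norm s0) (le_trans (dB _ _ nb))//.
  have -> : (f v).1 + ((1 + s) / 2 * (f v).2) *: v - ((f v).1 + (f v).2 *: v) =
      - ((1 - s) / 2) *: ((f v).2 *: v).
    by apply/rowP => i; rewrite !mxE; field.
  rewrite normrZ normrN normrM (@ger0_norm _ 2^-1)//.
  have := normr_ge0 (1 - s); have := normr_ge0 ((f v).2 *: v); nra.
- rewrite (ltr0_norm s0) (le_trans (dB _ _ na))// addrC addKr -scalerA.
  rewrite normrZ normrM (@ger0_norm _ 2^-1)// opprK.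
  have := normr_ge0 (1 + s); have := normr_ge0 ((f v).2 *: v); nra.
Qed.

Variable p : 'rV[R]_n.
Hypothesis Kp : K^° p.

Definition chord_map z := sphere_map (depth K) p (chord_point z).

Let depthp_gt0 : 0 < depth K p.
Proof. exact: depth_gt0 strictly_convex_bodyC _ Kp. Qed.

Lemma chord_map_sphere z : sphere R n (chord_map z).
Proof.
exact: (sphere_map_sphere (depth_ge0 strictly_convex_bodyC)
  (depth_lipschitz strictly_convex_bodyC) depthp_gt0).
Qed.

Lemma chord_map_dist_pole : exists2 C, 0 < C & forall z i,
  `|chord_map z ord0 i - (i == ord0)%:R| <= C * `|1 - `|z ord0 ord0| |.
Proof.
have [B B0 dB] := chord_point_depth.
have C0 : 0 < 4 / depth K p by rewrite divr_gt0.
exists (4 / depth K p * B); first by rewrite mulr_gt0.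
move=> z i; rewrite -[leRHS]mulrA.
apply: le_trans (ler_wpM2l (ltW C0) (dB z)).
exact: (sphere_map_dist_pole (depth_ge0 strictly_convex_bodyC)
  (depth_lipschitz strictly_convex_bodyC) depthp_gt0).
Qed.

Lemma sphere_poles z : sphere R n z -> col' ord0 z = 0 -> `|z ord0 ord0| = 1.
Proof.
move=> /sphereP; rewrite sumsq_split => + v_eq0; rewrite v_eq0.
rewrite [X in _ + X]sumsqE big1 => [|i _]; last by rewrite mxE expr0n.
rewrite addr0 => /eqP; rewrite sqrf_eq1.
by move=> /orP[]/eqP->; rewrite ?normrN normr1.
Qed.

Lemma chord_map_poles z : sphere R n z -> col' ord0 z = 0 ->
  chord_map z = delta_mx ord0 ord0.
Proof.
move=> zS v_eq0; have [C _ dC] := chord_map_dist_pole.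
apply/rowP => i; have := dC z i.
rewrite (sphere_poles zS v_eq0) subrr normr0 mulr0 normr_le0 subr_eq0.
move=> /eqP ->.
by rewrite [RHS]mxE eqxx.
Qed.

(** Chords need not converge as [v] tends to 0, but there [|s|] tends to 1 and the image tends to
    the pole at a rate linear in [|1 - |s||]. *)
Lemma chord_map_continuous z : sphere R n z -> {for z, continuous chord_map}.
Proof.
move=> zS; have [v_eq0|v_neq0] := eqVneq (col' ord0 z) 0; last first.
  apply: continuous_comp; first exact: chord_point_continuous.
  exact: (sphere_map_continuous (depth_ge0 strictly_convex_bodyC)
    (depth_lipschitz strictly_convex_bodyC) depthp_gt0
    (depth_continuous strictly_convex_bodyC)).
apply: row_continuous => i; have [C C0 dC] := chord_map_dist_pole.
have cg : {for z, continuous (fun y : 'rV[R]_n.+1 => `|1 - `|y ord0 ord0| |)}.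
  apply: (@continuous_comp _ _ _ (fun y : 'rV[R]_n.+1 => 1 - `|y ord0 ord0|)
    (fun t : R => `|t|)); last exact: norm_continuous.
  apply: continuousB; first exact: cst_continuous.
  apply: (@continuous_comp _ _ _ (fun y : 'rV[R]_n.+1 => y ord0 ord0)
    (fun t : R => `|t|)); last exact: norm_continuous.
  exact: coord_continuous.
apply: (@continuous_modulus _ _
  (fun y : 'rV[R]_n.+1 => C * `|1 - `|y ord0 ord0| |)) => [||y].
- by apply: continuousM => //; exact: cst_continuous.
- by rewrite (sphere_poles zS v_eq0) subrr normr0 mulr0.
- by rewrite (chord_map_poles zS v_eq0) [delta_mx _ _ _ _]mxE eqxx/= distrC.
Qed.

Lemma chord_mapN z : sphere R n z -> chord_map (- z) = chord_map z.
Proof.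
move=> zS; have [v_eq0|v_neq0] := eqVneq (col' ord0 z) 0; last first.
  by rewrite /chord_map chord_pointN.
rewrite (chord_map_poles zS v_eq0) chord_map_poles//; first exact: sphereN.
by rewrite col'N v_eq0 oppr0.
Qed.

(** Concavity of [depth] yields the ray condition of [sphere_map_inj], the strict gap being
    [(1 - r) * depth K p]. The direction of [z'] cannot vanish, since its chord point would then
    have depth 0. *)
Lemma chord_map_inj z z' : sphere R n z -> sphere R n z' ->
  col' ord0 z != 0 -> chord_map z = chord_map z' ->
  col' ord0 z' != 0 /\ chord_point z' = chord_point z.
Proof.
move=> zS z'S v_neq0 zz'.
have dz : 0 < depth K (chord_point z).
  by apply: (depth_gt0 strictly_convex_bodyC); exact: chord_point_interior.
have h := sphere_map_inj (depth_ge0 strictly_convex_bodyC)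
  (depth_lipschitz strictly_convex_bodyC) depthp_gt0 _ dz zz'.
have {}h : chord_point z = chord_point z'.
  apply: h => a r da /andP[r0 r1].
  have := depth_concave strictly_convex_bodyC (t := r)
    strictly_convex_body_convex depthp_gt0 da.
  rewrite r0 (ltW r1) => /(_ isT); apply: lt_le_trans.
  by rewrite ltrDr; apply: mulr_gt0; [rewrite subr_gt0|exact: depthp_gt0].
split; last exact: esym; apply/eqP => v'_eq0.
have [B _ dB] := chord_point_depth; have := dB z'.
by rewrite -h (sphere_poles z'S v'_eq0) subrr normr0 mulr0 leNgt dz.
Qed.

(** Positively proportional directions share their longest chord, so equal points force equal
    positions [s]; the equation of the sphere then gives [c ^+ 2 = 1]. *)
Lemma chord_point_parallel z z' (c : R) : sphere R n z -> sphere R n z' ->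
  col' ord0 z != 0 -> 0 < c -> col' ord0 z' = c *: col' ord0 z ->
  chord_point z' = chord_point z -> z' = z.
Proof.
move=> zS z'S v_neq0 c0 vv'; rewrite /chord_point vv'.
set v := col' ord0 z in v_neq0 vv' *.
have v'_neq0 : c *: v != 0 by rewrite scaler_eq0 negb_or gt_eqF.
case: (fP (c *: v)) => /(_ v'_neq0) lc' _ _ _.
case: (fP v) => /(_ v_neq0) lc _ _ _.
have [-> ->] := chord_unique lc' (longest_chordZ c0 lc).
have t0 := longest_chord_gt0 strictly_convex_body_interior lc.
move=> /addrI; rewrite scalerA => /eqP.
rewrite -subr_eq0 -scalerBl scaler_eq0 (negPf v_neq0) orbF subr_eq0.
rewrite -mulrA (divfK (lt0r_neq0 c0)) => /eqP/(mulIf (lt0r_neq0 t0)) s1.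
have s2 : z' ord0 ord0 = z ord0 ord0 by lra.
move/sphereP: zS; move/sphereP: z'S; rewrite !sumsq_split vv' s2 sumsqZ -/v.
move=> e1 e2; have vpos : 0 < sumsq v.
  by rewrite lt_def sumsq_ge0 andbT; apply: contra_neq v_neq0 => /sumsq_eq0.
have /eqP : c ^+ 2 = 1 by apply: (mulIf (lt0r_neq0 vpos)); rewrite mul1r; lra.
rewrite sqrf_eq1 => /orP[]/eqP c1; last by exfalso; lra.
apply/rowP => i; case: (unliftP ord0 i) => [j|] ->//.
by have := congr1 (fun w : 'rV_n => w ord0 j) vv'; rewrite c1 scale1r !mxE.
Qed.

(** Equal sections make the directions proportional. A positive factor reduces to
    [chord_point_parallel], a negative one to the same lemma for [- z]. *)
Lemma chord_line_inj z z' : sphere R n z -> sphere R n z' ->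
  col' ord0 z != 0 -> col' ord0 z' != 0 -> chord_point z' = chord_point z ->
  K `&` line (f (col' ord0 z')).1 (col' ord0 z') =
  K `&` line (f (col' ord0 z)).1 (col' ord0 z) ->
  z' = z \/ z' = - z.
Proof.
move=> zS z'S v_neq0 v'_neq0 xx' DD'.
set v := col' ord0 z in v_neq0 DD' *; set v' := col' ord0 z' in v'_neq0 DD' *.
case: (fP v') => /(_ v'_neq0) lc' [Ka Kb] _ _.
have t0 := longest_chord_gt0 strictly_convex_body_interior lc'.
(* Both ends of the chord along [v'] lie on the line along [v]; [al] and [be] are their positions
   there. *)
have [_ [al _ al1]] : (K `&` line (f v).1 v) (f v').1.
  by rewrite -DD'; split=> //; exists 0; rewrite //= scale0r addr0.
have [_ [be _ be1]] : (K `&` line (f v).1 v) ((f v').1 + (f v').2 *: v').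
  by rewrite -DD'; split=> //; exists (f v').2.
have vv' : v' = ((be - al) / (f v').2) *: v.
  apply: (scalerI (lt0r_neq0 t0)); rewrite scalerA mulrC divfK ?gt_eqF//.
  rewrite -(addKr (f v').1 (_ *: v')) -be1 -al1.
  by apply/rowP => i; rewrite !mxE; ring.
set c := _ / _ in vv'.
have [c0|c0|c0] := ltgtP c 0.
- right; have zNS := sphereN zS.
  apply: (@chord_point_parallel _ _ (- c)) => //.
  + by rewrite col'N oppr_eq0.
  + by rewrite oppr_gt0.
  + by rewrite col'N scaleNr scalerN opprK.
  + by rewrite chord_pointN.
- by left; apply: (@chord_point_parallel _ _ c).
- by move: v'_neq0; rewrite vv' c0 scale0r eqxx.
Qed.

Lemma chord_point_line z :
  line (f (col' ord0 z)).1 (col' ord0 z) (chord_point z).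
Proof. by exists ((1 + z ord0 ord0) / 2 * (f (col' ord0 z)).2). Qed.

End ChordMap.

(** * Descent to the projective space and comparison of fibers with affine diameters *)

(** The choice [repr] of representatives need not be continuous, but composing it with a continuous
    map constant on antipodal pairs gives a continuous map on the quotient. The formula for [F] lets
    fibers be read on representatives. *)
Lemma continuous_sphere_quotient (R : realType) (n : nat)
    (g : 'rV[R]_n.+1 -> 'rV[R]_n.+1) :
  (forall z, sphere R n (g z)) ->
  (forall z, sphere R n z -> {for z, continuous g}) ->
  (forall z, sphere R n z -> g (- z) = g z) ->
  exists F : RP R n -> sphere R n,
    continuous F /\ forall q, val (F q) = g (val (repr q)).
Proof.
move=> gS cg gN.
pose G (x : sphere R n) : sphere R n :=
  exist _ (g (val x)) (mem_set (gS (val x))).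
exists (G \o repr); split=> //; apply: repr_comp_continuous.
  apply: continuous_comp_initial => x.
  apply: (@continuous_comp _ _ _ (val : sphere R n -> _) g).
    exact: initial_continuous.
  by apply: cg; exact: set_mem (valP x).
move=> a b /eqP/eqmodP ab; apply/eqP/val_inj => /=.
move: ab; rewrite /antipodal/= => /orP[/eqP->//|/eqP->].
by apply: gN; exact: set_mem (valP b).
Qed.

Lemma RP_eq (R : realType) (n : nat) (q r : RP R n) :
  val (repr q) = val (repr r) \/ val (repr q) = - val (repr r) -> q = r.
Proof.
move=> qr; rewrite -(reprK q) -(reprK r); apply/eqmodP.
by rewrite /antipodal/=; apply/orP; case: qr => ->; rewrite eqxx; [left|right].
Qed.

Lemma card_le_inj (T U : Type) (A : set T) (B : set U) (g : T -> U) :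
  (forall x, A x -> B (g x)) ->
  (forall x y, A x -> A y -> g x = g y -> x = y) -> A #<= B.
Proof.
move=> gAB ginj; apply: inj_card_le; apply: unsquash; apply/injfunPex.
by exists g => // x y /set_mem Ax /set_mem Ay; exact: ginj.
Qed.

Theorem theorem2p4 (R : realType) (d : nat) (K : set 'rV[R]_d) :
  (1 <= d)%N ->
  strictly_convex_body K ->
  exists p : 'rV[R]_d, interior K p /\
    `I_(kappa R d) #<= [set D : set 'rV[R]_d | affine_diameter K D /\ D p].
Proof.
move=> d1 bodyK.
have [f fP] := chord_selection_exists bodyK d1.
(* This [p] only serves as the centre of [sphere_map]; the common point of the diameters is found
   from a large fiber. *)
have [p Kp] := strictly_convex_body_interior bodyK.
have [F [cF FE]] := continuous_sphere_quotient
  (chord_map_sphere bodyK d1 f Kp)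
  (chord_map_continuous bodyK d1 fP Kp)
  (chord_mapN bodyK d1 fP Kp).
have [y ky] := (kappaP R d).1 F cF.
have reprS (q : RP R d) : sphere R d (val (repr q)).
  exact: set_mem (valP (repr q)).
(* Either the large fiber contains a class with nonzero direction, whose chord point is then the
   common point, or all its classes have direction 0. *)
have [[q [Fq q_neq0]]|yN] := pselect
  (exists q, F q = y /\ col' ord0 (val (repr q)) != 0).
- exists (chord_point f (val (repr q))).
  have fiber r : F r = y -> col' ord0 (val (repr r)) != 0 /\
      chord_point f (val (repr r)) = chord_point f (val (repr q)).
    move=> Fr; apply: (chord_map_inj bodyK d1 fP Kp (reprS q) (reprS r) q_neq0).
    by rewrite -!FE Fq Fr.
  split; first exact: (chord_point_interior bodyK fP).
  apply: (card_le_trans ky); pose v (r : RP R d) := col' ord0 (val (repr r)).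
  apply: (@card_le_inj _ _ _ _ (fun r => K `&` line (f (v r)).1 (v r))).
    move=> r /fiber[r_neq0 rq]; case: (fP (v r)) => /(_ r_neq0) lc _ _ _.
    split; first exact: chord_affine_diameter lc.
    rewrite -rq; split; last exact: chord_point_line.
    by apply: interior_subset; exact: (chord_point_interior bodyK fP).
  move=> r s /fiber[r_neq0 rq] /fiber[s_neq0 sq] rs; apply: RP_eq.
  by apply: (chord_line_inj bodyK fP) => //; rewrite rq sq.
(* Only the pole of [RP^d] is sent to the pole of the sphere, so this fiber is a
   singleton and any affine diameter will do. *)
- have [v0 v0_neq0] := @row_neq0 R d d1.
  have [[a t] /= lc] := strictly_convex_body_chord bodyK v0_neq0.
  exists (a + (2^-1 * t) *: v0); split.
    by apply: (chord_interior bodyK) => //; apply/andP; split; lra.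
  apply: (card_le_trans ky).
  apply: (@card_le_inj _ _ _ _ (fun=> K `&` line a v0)).
    move=> r _; split; first exact: chord_affine_diameter lc.
    split; last by exists (2^-1 * t).
    apply: interior_subset; apply: (chord_interior bodyK) => //.
    by apply/andP; split; lra.
  have pole r : F r = y -> col' ord0 (val (repr r)) = 0.
    by move=> Fr; apply/eqP/negPn/negP => r_neq0; apply: yN; exists r.
  move=> r s /pole r0 /pole s0 _; apply: RP_eq.
  have : (val (repr r) ord0 ord0 == val (repr s) ord0 ord0) ||
      (val (repr r) ord0 ord0 == - val (repr s) ord0 ord0).
    by rewrite -eqr_norm2 !(sphere_poles (reprS _)).
  have colE i j : (val (repr r)) i (lift ord0 j) = 0 /\
      val (repr s) i (lift ord0 j) = 0.
    have := congr1 (fun w : 'rV_d => w i j) r0.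
    by have := congr1 (fun w : 'rV_d => w i j) s0; rewrite !mxE.
  case/orP => /eqP rs; [left|right]; apply/rowP => i.
    by case: (unliftP ord0 i) => [j|] ->//; have [-> ->] := colE ord0 j.
  rewrite [RHS]mxE.
  case: (unliftP ord0 i) => [j|] ->//.
  by have [-> ->] := colE ord0 j; rewrite oppr0.
Qed.
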